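(* Let $\delta\in(0,1)$ and $n\in\mathbb N$. If $\mu^*\in S_\delta$ is a maximizer, i.e. $|\phi_n(1,\mu^* )|=M_{n,\delta}$, then it can be written in the form $$d\mu^*=(2\pi)^{-1}\delta\,d\theta+\sum_{j=1}^N m_j\delta_{\theta_j},\qquad 1\le N\le n,$$ where $m_j\ge0$ and $-\pi<\theta_1<\ldots<\theta_N\le\pi$.
   Context: $\mathbb T$ is the unit circle, identified with $(-\pi,\pi]$ via $\theta\mapsto e^{i\theta}$; $\delta_{\theta_j}$ denotes the unit point mass at $e^{i\theta_j}$ (while $\delta$ without index is the number in $(0,1)$). For $\delta\in(0,1)$ the Steklov class $S_\delta$ is the set of probability measures $\sigma$ on $\mathbb T$ such that $\sigma'(\theta)\ge \delta/(2\pi)$ at every Lebesgue point of $\sigma$ (equivalently a.e.), where $\sigma'$ is the density of the absolutely continuous part of $\sigma$ with respect to $d\theta$. For $\sigma\in S_\delta$, $\phi_n(z,\sigma)=\lambda_n z^n+\ldots$, $\lambda_n>0$, are the polynomials orthonormal with respect to $\sigma$. Define $M_{n,\delta}=\sup_{\sigma\in S_\delta}\|\phi_n(z,\sigma)\|_{L^\infty(\mathbb T)}$; by rotation invariance of $S_\delta$ this equals $\sup_{\sigma\in S_\delta}|\phi_n(1,\sigma)|$. *)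

(* Defs.v *)
From HB Require Import structures.
From mathcomp Require Import all_boot all_order all_algebra.
From mathcomp Require Import complex.
From mathcomp Require Import all_classical all_reals all_analysis.

Set Implicit Arguments.
Unset Strict Implicit.
Unset Printing Implicit Defensive.

Import Order.TTheory GRing.Theory Num.Theory.
Import numFieldNormedType.Exports.

Local Open Scope classical_set_scope.
Local Open Scope ring_scope.
Local Open Scope complex_scope.

(* The unit circle is identified with (-pi, pi] through t |-> e^{it}: a measure
   on the circle is a Borel measure on the line concentrated on [arc]. *)
Definition arc (R : realType) : set (measurableTypeR R) := `]- pi, pi]%classic.
Arguments arc : clear implicits.

Lemma measurable_arc (R : realType) : measurable (arc R).
Proof. exact: measurable_itv. Qed.

(* d theta, of total mass 2 pi (not normalized). *)
Definition dtheta (R : realType) : {measure set (measurableTypeR R) -> \bar R} :=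
  mrestr (@lebesgue_measure R) (@measurable_arc R).
Arguments dtheta : clear implicits.

Definition expi (R : realType) (t : R) : R[i] := cos t +i* sin t.

Definition circle_probability (R : realType)
    (sigma : probability (measurableTypeR R) R) : Prop :=
  sigma (arc R) = 1%E.

Definition singular (d : measure_display) (T : measurableType d) (R : realType)
    (mu nu : {measure set T -> \bar R}) : Prop :=
  exists E : set T, [/\ measurable E, mu (~` E) = 0%E & nu E = 0%E].

(* Lebesgue decomposition: sigma = f d theta + s with s singular, so that f is
   (a version of) sigma', the density of the absolutely continuous part. *)
Definition is_ac_density (R : realType)
    (sigma : {measure set (measurableTypeR R) -> \bar R})
    (f : measurableTypeR R -> R) : Prop :=
  [/\ measurable_fun setT f, (forall t, 0 <= f t) &
      exists2 s : {measure set (measurableTypeR R) -> \bar R},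
        singular s (dtheta R) &
        forall A, measurable A ->
          sigma A = (\int[dtheta R]_(t in A) (f t)%:E + s A)%E].

Definition steklov (R : realType) (delta : R) :
    set (probability (measurableTypeR R) R) :=
  [set sigma | circle_probability sigma /\
     exists2 f, is_ac_density sigma f &
       {ae dtheta R, forall t, delta / (2 * pi) <= f t}].

(* Integral of a complex-valued function, by real and imaginary parts. *)
Definition Cintegral (R : realType)
    (sigma : {measure set (measurableTypeR R) -> \bar R})
    (f : measurableTypeR R -> R[i]) : R[i] :=
  Rintegral sigma (arc R) (fun t => complex.Re (f t)) +i*
  Rintegral sigma (arc R) (fun t => complex.Im (f t)).

Definition inner (R : realType)
    (sigma : {measure set (measurableTypeR R) -> \bar R})
    (p q : {poly R[i]}) : R[i] :=
  Cintegral sigma (fun t => p.[expi t] * conjc q.[expi t]).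

(* In R[i], [0 < z] means that z is real and positive. *)
Definition orthonormal_polys (R : realType)
    (sigma : {measure set (measurableTypeR R) -> \bar R})
    (phi : nat -> {poly R[i]}) : Prop :=
  [/\ forall k, size (phi k) = k.+1,
      forall k, 0 < lead_coef (phi k) &
      forall k l, inner sigma (phi k) (phi l) = (k == l)%:R].

(* phi_n(., sigma). The sequence exists and is unique as soon as the support of
   sigma is infinite, in particular for sigma in a Steklov class; the default
   value 0 is only met outside of that case. *)
Definition opoly (R : realType)
    (sigma : {measure set (measurableTypeR R) -> \bar R}) : nat -> {poly R[i]} :=
  xget (fun=> 0) [set phi | orthonormal_polys sigma phi].

Definition cmod (R : realType) (z : R[i]) : R := complex.Re `|z|.

Definition Linfty_norm (R : realType) (p : {poly R[i]}) : \bar R :=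
  Lnorm (dtheta R) +oo%E (fun t => (cmod p.[expi t])%:E).

Definition steklov_sup (R : realType) (n : nat) (delta : R) : \bar R :=
  ereal_sup [set Linfty_norm (opoly sigma n) | sigma in steklov delta].

(* Main.v *)
Require Import Defs.
From HB Require Import structures.
From mathcomp Require Import all_boot all_order all_algebra.
From mathcomp Require Import complex.
From mathcomp Require Import all_classical all_reals all_analysis.
From mathcomp Require Import measurable_realfun ess_sup_inf ring lra.

(** Let c = delta / (2 pi), let phi_k be the orthonormal polynomials of mu and
    let k_m = \sum_(k < m) conj(phi_k(1)) phi_k be the kernel that reproduces
    evaluation at 1 on polynomials of degree < m. Then <k_m, k_m> = k_m(1) and
    |phi_n(1)|^2 = k_(n+1)(1) - k_n(1).

    First variation. If nu is another measure of the Steklov class, so is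
    sigma_t = (1 - t) mu + t nu for 0 < t < 1. The number k_m(1) is the maximum
    of 2 Re p(1) - <p, p> over polynomials of degree < m, and k_m is the
    maximizer. Testing this extremal problem for sigma_t with the kernel
    k_(n+1) of mu bounds k_(n+1)(1) from below for sigma_t; completing the
    square around the kernel k_n of mu bounds k_n(1) from above for sigma_t, up
    to an error of order t^2 ([christoffel_mix_le]). Hence |phi_n(1)|^2 grows
    at rate at least \int gap d(nu - mu), where
      gap = |k_n|^2 - |k_(n+1)|^2  on the circle,
    and maximality of mu forces \int gap dnu <= \int gap dmu
    ([first_variation], [maximizer_first_order]).

    Concentration. Write mu = c dtheta + rho with rho a positive measure of mass
    1 - delta, and choose nu = c dtheta + (1 - delta) (point mass at a maximum
    point of gap). The inequality becomes
    (1 - delta) max gap <= \int gap drho, so rho is carried by the set where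
    gap is maximal ([residual_concentrated]).

    Counting. On the circle z^n (max gap - gap) is a polynomial in z of degree
    at most 2n. Its coefficient of z^(2n) is the leading coefficient of k_(n+1)
    times conj(k_(n+1)(0)); both factors are nonzero because phi_n(1) is
    ([kernel_at1_top], [kernel_at1_at0]). A maximum point of gap is a zero of a
    nonnegative function, hence a double root, so that there are at most n of
    them ([size_touching_points]). *)

Set Implicit Arguments.
Unset Strict Implicit.
Unset Printing Implicit Defensive.

Import Order.TTheory GRing.Theory Num.Theory.
Import numFieldNormedType.Exports.

Local Open Scope classical_set_scope.
Local Open Scope ring_scope.

Local Notation arc := Defs.arc.

(** * Complex numbers in real coordinates *)

Section ComplexParts.
Variable R : rcfType.
Implicit Types (x : R) (z w : R[i]).

Lemma complex_eq z w :
  complex.Re z = complex.Re w -> complex.Im z = complex.Im w -> z = w.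
Proof. by case: z => a b; case: w => c d /= -> ->. Qed.

Lemma Re_addc z w : complex.Re (z + w) = complex.Re z + complex.Re w.
Proof. by case: z => a b; case: w => c d. Qed.

Lemma Im_addc z w : complex.Im (z + w) = complex.Im z + complex.Im w.
Proof. by case: z => a b; case: w => c d. Qed.

Lemma Re_oppc z : complex.Re (- z) = - complex.Re z.
Proof. by case: z. Qed.

Lemma Re_subc z w : complex.Re (z - w) = complex.Re z - complex.Re w.
Proof. by rewrite Re_addc Re_oppc. Qed.

Lemma Re_mulc z w : complex.Re (z * w) =
  complex.Re z * complex.Re w - complex.Im z * complex.Im w.
Proof. by case: z => a b; case: w => c d. Qed.

Lemma Im_mulc z w : complex.Im (z * w) =
  complex.Re z * complex.Im w + complex.Im z * complex.Re w.
Proof. by case: z => a b; case: w => c d. Qed.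

Lemma Re_conjc z : complex.Re (conjc z) = complex.Re z.
Proof. by case: z. Qed.

Lemma Im_conjc z : complex.Im (conjc z) = - complex.Im z.
Proof. by case: z. Qed.

Lemma Re_sum (I : Type) (r : seq I) (P : pred I) (F : I -> R[i]) :
  complex.Re (\sum_(i <- r | P i) F i) = \sum_(i <- r | P i) complex.Re (F i).
Proof. exact: (big_morph _ Re_addc). Qed.

Definition sqmod z : R := complex.Re z ^+ 2 + complex.Im z ^+ 2.

Lemma sqmod_ge0 z : 0 <= sqmod z.
Proof. by rewrite addr_ge0 ?sqr_ge0. Qed.

Lemma sqmod_eq0 z : sqmod z = 0 -> z = 0.
Proof.
move/eqP; rewrite paddr_eq0 ?sqr_ge0// !sqrf_eq0 => /andP[/eqP a /eqP b].
exact: complex_eq.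
Qed.

Lemma mulc_conjc z : z * conjc z = (sqmod z)%:C%C.
Proof.
apply: complex_eq; rewrite ?Re_mulc ?Im_mulc ?Re_conjc ?Im_conjc /sqmod/=; ring.
Qed.

End ComplexParts.

(** * Hermitian forms on polynomials and orthonormal sequences *)

Section Forms.
Variable R : rcfType.
Local Notation C := R[i].
Implicit Types (p q r : {poly C}) (B : {poly C} -> {poly C} -> C).

Record hermitian_form B : Prop := HermitianForm {
  form_scalar : forall r, scalar (B^~ r);
  formC : forall p q, B q p = conjc (B p q);
  form_ge0 : forall p, 0 <= complex.Re (B p p) }.

Definition definite B := forall p, complex.Re (B p p) = 0 -> p = 0.

(** Multiplication by z preserves the forms \int p conj(q) dsigma because
    |z| = 1 on the circle. *)
Definition isometric_shift B := forall p q, B ('X * p) ('X * q) = B p q.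

(** [orthonormal_polys sigma] is convertible to
    [orthonormal_seq (inner sigma)]. *)
Definition orthonormal_seq B (phi : nat -> {poly C}) :=
  [/\ forall k, size (phi k) = k.+1,
      forall k, 0 < lead_coef (phi k) &
      forall k l, B (phi k) (phi l) = (k == l)%:R].

Lemma scalar0 (L : {poly C} -> C) : scalar L -> L 0 = 0.
Proof.
by move=> hL; have := hL (-1) 0 0; rewrite scaler0 addr0 mulN1r addNr.
Qed.

Lemma scalar_sum (L : {poly C} -> C) m (a : nat -> C) (f : nat -> {poly C}) :
  scalar L -> L (\sum_(k < m) a k *: f k) = \sum_(k < m) a k * L (f k).
Proof.
move=> hL; elim: m => [|m IH]; first by rewrite !big_ord0 scalar0.
by rewrite !big_ord_recr/= addrC hL IH addrC.
Qed.

Section FormTheory.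
Variable B : {poly C} -> {poly C} -> C.
Hypothesis hB : hermitian_form B.

Lemma formDl p q r : B (p + q) r = B p r + B q r.
Proof. by have := form_scalar hB r 1 p q; rewrite scale1r mul1r. Qed.

Lemma formZl a p r : B (a *: p) r = a * B p r.
Proof.
have := form_scalar hB r a p 0.
by rewrite addr0 (scalar0 (form_scalar hB r)) addr0.
Qed.

Lemma formDr p q r : B r (p + q) = B r p + B r q.
Proof. by rewrite (formC hB) formDl rmorphD/= -!(formC hB). Qed.

Lemma formZr a p r : B r (a *: p) = conjc a * B r p.
Proof. by rewrite (formC hB) formZl rmorphM/= -(formC hB). Qed.

Lemma formNl p r : B (- p) r = - B p r.
Proof. by rewrite -scaleN1r formZl mulN1r. Qed.

Lemma formBl p q r : B (p - q) r = B p r - B q r.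
Proof. by rewrite formDl formNl. Qed.

Lemma Im_form p : complex.Im (B p p) = 0.
Proof.
have := congr1 (@complex.Im R) (formC hB p p); rewrite Im_conjc.
by move/eqP; rewrite -addr_eq0 -mulr2n mulrn_eq0/= => /eqP.
Qed.

Lemma Re_formDD p r :
  complex.Re (B (p + r) (p + r)) =
  complex.Re (B p p) + 2 * complex.Re (B r p) + complex.Re (B r r).
Proof.
rewrite !(formDl, formDr) !Re_addc (formC hB r p) Re_conjc; ring.
Qed.

Variable phi : nat -> {poly C}.
Hypothesis hphi : orthonormal_seq B phi.

Lemma orthonormal_form_sum m (a : nat -> C) j : (j < m)%N ->
  B (\sum_(k < m) a k *: phi k) (phi j) = a j.
Proof.
have [_ _ on] := hphi.
move=> jm; rewrite (scalar_sum _ _ _ (form_scalar hB _)).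
rewrite (bigD1 (Ordinal jm))//= on eqxx mulr1 big1 ?addr0// => i.
by rewrite -val_eqE/= on => /negbTE ->; rewrite mulr0.
Qed.

Lemma parseval m (a : nat -> C) (p := \sum_(k < m) a k *: phi k) :
  complex.Re (B p p) = \sum_(k < m) sqmod (a k).
Proof.
have -> : B p p = \sum_(k < m) a k * conjc (a k).
  rewrite {1}/p (scalar_sum _ _ _ (form_scalar hB _)).
  by apply: eq_bigr => k _; rewrite (formC hB) orthonormal_form_sum.
by rewrite Re_sum; apply: eq_bigr => k _; rewrite mulc_conjc.
Qed.

End FormTheory.

Lemma graded_span (phi : nat -> {poly C}) m p :
  (forall k, (k < m)%N -> size (phi k) = k.+1) -> (size p <= m)%N ->
  exists a : nat -> C, p = \sum_(k < m) a k *: phi k.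
Proof.
elim: m p => [|m IH] p sphi sp.
  by exists (fun=> 0); rewrite big_ord0; apply/eqP; rewrite -size_poly_leq0.
have sm := sphi m (ltnSn m).
have lm0 : lead_coef (phi m) != 0 by rewrite lead_coef_eq0 -size_poly_gt0 sm.
pose c := p`_m / lead_coef (phi m).
have [||a pE] := IH (p - c *: phi m).
- by move=> k km; apply: sphi; rewrite ltnW.
- apply/leq_sizeP => j; rewrite leq_eqVlt => /predU1P[<-|mj].
    by rewrite coefB coefZ -[(phi m)`_m]/((phi m)`_m.+1.-1) -sm -lead_coefE
      divfK ?subrr.
  rewrite coefB coefZ !nth_default ?mulr0 ?subrr// ?sm//.
  exact: leq_trans sp mj.
exists (fun k => if k == m then c else a k).
rewrite big_ord_recr/= eqxx -[LHS](subrK (c *: phi m)) pE; congr +%R.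
by apply: eq_bigr => i _; rewrite ltn_eqF.
Qed.

(** * Reproducing kernels at 1 *)

Section Extremal.
Variable B : {poly C} -> {poly C} -> C.
Hypothesis hB : hermitian_form B.
Variable phi : nat -> {poly C}.
Hypothesis hphi : orthonormal_seq B phi.

Let sphi k : size (phi k) = k.+1. Proof. by have [] := hphi. Qed.

(** In coordinates a_k along the orthonormal basis the left-hand side is
    \sum_k (2 Re(a_k L(phi_k)) - s |a_k|^2), and each term is bounded separately
    by completing the square. With L = evaluation at 1 and s = 1 this is the
    extremal property of the kernel; with L a small perturbation it bounds the
    second-order term in [christoffel_mix_le]. *)
Lemma scalar_minus_form_le (L : {poly C} -> C) (s : R) m p :
  scalar L -> 0 < s -> (size p <= m)%N ->
  2 * complex.Re (L p) - s * complex.Re (B p p) <=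
  (\sum_(k < m) sqmod (L (phi k))) / s.
Proof.
move=> hL s0 sp; have [a ->] := graded_span (fun k _ => sphi k) sp.
rewrite (scalar_sum _ _ _ hL) (parseval hB hphi) Re_sum mulrC !big_distrl/=.
rewrite [s * _]mulrC big_distrl -sumrB/=; apply: ler_sum => k _.
rewrite ler_pdivlMr//; move: (a k) (L (phi k)) => [x y] [u v].
rewrite /sqmod Re_mulc/=.
have := sqr_ge0 (x * s - u); have := sqr_ge0 (y * s + v); nra.
Qed.

(** [kernel_at1 m] reproduces evaluation at 1 on polynomials of degree < m; the
    bound is strict, so the kernel of degree n is [kernel_at1 n.+1]. Its value
    at 1, [christoffel m], is the reciprocal of the Christoffel function. *)
Definition kernel_at1 m : {poly C} := \sum_(k < m) conjc (phi k).[1] *: phi k.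
Definition christoffel m := \sum_(k < m) sqmod (phi k).[1].

Lemma size_kernel_at1 m : (size (kernel_at1 m) <= m)%N.
Proof.
rewrite (leq_trans (size_sum _ _ _))//; apply/bigmax_leqP => k _.
by rewrite (leq_trans (size_scale_leq _ _))// sphi.
Qed.

Lemma kernel_at1_reproducing m p :
  (size p <= m)%N -> B p (kernel_at1 m) = p.[1].
Proof.
move=> /(graded_span (fun k _ => sphi k))[a ->].
rewrite (formC hB) /kernel_at1.
rewrite (scalar_sum _ (fun k => conjc (phi k).[1]) _ (form_scalar hB _)).
rewrite rmorph_sum horner_sum/=.
apply: eq_bigr => k _; rewrite hornerZ rmorphM/= conjcK mulrC; congr (_ * _).
by rewrite -(formC hB) (orthonormal_form_sum hB hphi).
Qed.

Lemma kernel_at1_1 m : (kernel_at1 m).[1] = (christoffel m)%:C%C.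
Proof.
rewrite horner_sum rmorph_sum/=; apply: eq_bigr => k _.
by rewrite hornerZ mulrC mulc_conjc.
Qed.

Lemma kernel_at1_norm m :
  complex.Re (B (kernel_at1 m) (kernel_at1 m)) = christoffel m.
Proof. by rewrite kernel_at1_reproducing ?size_kernel_at1// kernel_at1_1. Qed.

Lemma christoffelS m : christoffel m.+1 = christoffel m + sqmod (phi m).[1].
Proof. by rewrite /christoffel big_ord_recr. Qed.

Lemma christoffel_extremal m p : (size p <= m)%N ->
  2 * complex.Re p.[1] - complex.Re (B p p) <= christoffel m.
Proof.
move=> sp; have hL : scalar (fun q : {poly C} => q.[1]).
  by move=> a q r; rewrite hornerD hornerZ.
by have := scalar_minus_form_le hL ltr01 sp; rewrite mul1r divr1.
Qed.

Hypothesis shB : isometric_shift B.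

Lemma orthonormal_deg_lt n p : (size p <= n)%N -> B p (phi n) = 0.
Proof.
have [_ _ on] := hphi.
move=> /(graded_span (fun k _ => sphi k))[a ->].
rewrite (scalar_sum _ _ _ (form_scalar hB _)) big1// => k _.
by rewrite on ltn_eqF ?mulr0.
Qed.

(** If phi_n = (z - 1) q, then z q = phi_n + q with phi_n orthogonal to q, so
    |z q|^2 = 1 + |q|^2, contradicting |z q| = |q|. *)
Lemma orthonormal_root1 n : (phi n).[1] != 0.
Proof.
have [_ _ on] := hphi.
apply/negP => /factor_theorem[q phiE].
have q0 : q != 0.
  by apply/eqP => q0; have := sphi n; rewrite phiE q0 mul0r size_poly0.
have sq : size q = n.
  have := sphi n.
  by rewrite phiE size_Mmonic ?monicXsubC// size_XsubC addn2 => -[].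
have Xq : 'X * q = phi n + q by rewrite phiE mulrBr mulrC mulr1 subrK.
have := Re_formDD hB (phi n) q.
rewrite -Xq shB (orthonormal_deg_lt (eq_leq sq)).
by rewrite mulr0 addr0 on eqxx/=; lra.
Qed.

Lemma kernel_at1_top n : (kernel_at1 n.+1)`_n != 0.
Proof.
have [_ lphi _] := hphi.
rewrite /kernel_at1 big_ord_recr coefD coefZ.
rewrite [X in X + _]nth_default ?size_kernel_at1// add0r.
rewrite mulf_neq0 ?conjc_eq0 ?orthonormal_root1//.
by have := lphi n; rewrite lead_coefE sphi => /lt0r_neq0.
Qed.

(** If k_(n+1) = z q, then q has degree < n and |q|^2 = |k_(n+1)|^2 =
    k_(n+1)(1) = q(1), so the extremal property of k_n gives
    k_(n+1)(1) <= k_n(1), i.e. phi_n(1) = 0. *)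
Lemma kernel_at1_at0 n : (kernel_at1 n.+1).[0] != 0.
Proof.
apply/negP => /factor_theorem[q kE]; rewrite subr0 mulrC in kE.
have sq : (size q <= n)%N.
  have [->|q0] := eqVneq q 0; first by rewrite size_poly0.
  by have := size_kernel_at1 n.+1; rewrite kE mulrC size_mulX.
have q1 : q.[1] = (christoffel n.+1)%:C%C.
  by rewrite -kernel_at1_1 kE hornerM hornerX mul1r.
have := christoffel_extremal sq; rewrite q1/= -shB -kE kernel_at1_norm.
rewrite christoffelS => le0; have /eqP := orthonormal_root1 n; apply.
by apply/sqmod_eq0/le_anti; rewrite sqmod_ge0 andbT; lra.
Qed.

End Extremal.

(** * Variation of the form *)

Section Perturbation.
Variables (B0 B1 : {poly C} -> {poly C} -> C).
Hypotheses (hB0 : hermitian_form B0) (hB1 : hermitian_form B1).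

Definition mix (t : R) p q := (1 - t)%:C%C * B0 p q + t%:C%C * B1 p q.

Lemma Re_mix t p : complex.Re (mix t p p) =
  (1 - t) * complex.Re (B0 p p) + t * complex.Re (B1 p p).
Proof. by rewrite /mix Re_addc !Re_mulc/= !mul0r !subr0. Qed.

Lemma hermitian_mix (t : R) : 0 <= t <= 1 -> hermitian_form (mix t).
Proof.
move=> /andP[t0 t1]; split => [r a p q|p q|p].
- rewrite /mix (form_scalar hB0) (form_scalar hB1); ring.
- rewrite /mix [in RHS]rmorphD ![in RHS]rmorphM/= !oppr0.
  by rewrite -!(formC hB0) -!(formC hB1).
- rewrite Re_mix addr_ge0 ?mulr_ge0 ?(form_ge0 hB0) ?(form_ge0 hB1) //.
  by rewrite subr_ge0.
Qed.

Variable phi : nat -> {poly C}.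
Hypothesis hphi : orthonormal_seq B0 phi.

Local Notation k_ m := (kernel_at1 phi m).

(** Let k and q be the kernels of B0 and of [mix t], and r = q - k. The value
    2 Re q(1) - [mix t](q, q), expanded around k, is an affine function of t
    plus 2 t Re(B0(r, k) - B1(r, k)) - (1 - t) B0(r, r) - t B1(r, r). The last
    term is nonpositive, and the other two are at most of order t^2 whatever r
    is, by [scalar_minus_form_le]. *)
Lemma christoffel_mix_le m (t : R) psi :
  0 < t < 1 -> orthonormal_seq (mix t) psi ->
  christoffel psi m <= christoffel phi m
    + t * (christoffel phi m - complex.Re (B1 (k_ m) (k_ m)))
    + t ^+ 2 * (\sum_(k < m) sqmod (B0 (phi k) (k_ m) - B1 (phi k) (k_ m)))
      / (1 - t).
Proof.
move=> /andP[t0 t1] hpsi.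
have hBt : hermitian_form (mix t) by apply: hermitian_mix; rewrite !ltW.
set k := k_ m; pose q := kernel_at1 psi m; pose r := q - k.
have sr : (size r <= m)%N.
  apply: leq_trans (size_polyD _ _) _; rewrite size_polyN geq_max.
  by rewrite /q (size_kernel_at1 hpsi) (size_kernel_at1 hphi).
pose L p : C := t%:C%C * (B0 p k - B1 p k).
have hL : scalar L.
  by move=> a p p'; rewrite /L (form_scalar hB0) (form_scalar hB1); ring.
have t1' : 0 < 1 - t by rewrite subr_gt0.
have := scalar_minus_form_le hB0 hphi hL t1' sr.
have -> : \sum_(j < m) sqmod (L (phi j)) =
    t ^+ 2 * \sum_(j < m) sqmod (B0 (phi j) k - B1 (phi j) k).
  rewrite big_distrr; apply: eq_bigr => j _ /=.
  by rewrite /L /sqmod Re_mulc Im_mulc/=; ring.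
rewrite /L Re_mulc/= mul0r subr0 Re_subc.
set S := _ / (1 - t); clearbody S.
have qk : q = k + r by rewrite addrC subrK.
have := kernel_at1_norm hBt hpsi m; rewrite -/q Re_mix => normq.
have q1 : complex.Re (B0 q k) = christoffel psi m.
  rewrite (kernel_at1_reproducing hB0 hphi) ?(size_kernel_at1 hpsi)//.
  by rewrite kernel_at1_1.
clearbody r q; move: normq; rewrite qk (Re_formDD hB0) (Re_formDD hB1) => normq.
have := form_ge0 hB1 r.
move: q1; rewrite qk (formDl hB0) Re_addc (kernel_at1_norm hB0 hphi).
rewrite !(kernel_at1_norm hB0 hphi) in normq *.
move: normq; move: (complex.Re (B0 r k)) (complex.Re (B1 r k)) => x y.
move: (complex.Re (B0 r r)) => z.
move: (complex.Re (B1 r r)) (complex.Re (B1 k k)) (christoffel phi m) => u v K.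
move=> h1 h2 u0; have : 0 <= t * u by rewrite mulr_ge0// ltW.
nra.
Qed.

(** The derivative at t = 0 of |psi_n(1)|^2 = K_(n+1) - K_n, where K_m is the
    value at 1 of the m-th kernel of [mix t], is
    (B1 - B0)(k_n, k_n) - (B1 - B0)(k_(n+1), k_(n+1)). The lower bound for
    K_(n+1) and the upper bound for K_n show that it is at least this number,
    which a maximum at t = 0 then makes nonpositive. *)
Lemma first_variation n :
  (forall t, 0 < t < 1 -> exists2 psi, orthonormal_seq (mix t) psi &
     sqmod (psi n).[1] <= sqmod (phi n).[1]) ->
  complex.Re (B1 (k_ n) (k_ n)) - complex.Re (B1 (k_ n.+1) (k_ n.+1)) <=
  complex.Re (B0 (k_ n) (k_ n)) - complex.Re (B0 (k_ n.+1) (k_ n.+1)).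
Proof.
move=> phimax.
set c := \sum_(k < n) sqmod (B0 (phi k) (k_ n) - B1 (phi k) (k_ n)).
have c0 : 0 <= c by apply: sumr_ge0 => k _; exact: sqmod_ge0.
set E1 := complex.Re (B1 _ _); set E2 := complex.Re (B1 _ _).
rewrite !(kernel_at1_norm hB0 hphi) -/E1 -/E2.
have step (t : R) : 0 < t < 1 ->
    (1 - t) * (E1 - E2 - (christoffel phi n - christoffel phi n.+1)) <= t * c.
  move=> t01; have [psi hpsi] := phimax t t01.
  have := christoffel_mix_le n t01 hpsi.
  rewrite -/c -/E1; case/andP: t01 => t0 t1.
  have hBt : hermitian_form (mix t) by apply: hermitian_mix; rewrite !ltW.
  have := christoffel_extremal hBt hpsi (size_kernel_at1 hphi n.+1).
  rewrite Re_mix (kernel_at1_norm hB0 hphi) -/E2 kernel_at1_1/= !christoffelS.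
  have t1' : 0 < 1 - t by rewrite subr_gt0.
  move: (christoffel _ _) (christoffel _ _) (sqmod _) (sqmod _) => x y u v.
  rewrite -subr_ge0 -(subr_ge0 x).
  move=> h1 h2 h3.
  have : 0 <= t * (t * c / (1 - t) - (E1 - E2 - (y - (y + v)))) by nra.
  rewrite pmulr_rge0// subr_ge0 ler_pdivlMr// => h.
  by rewrite mulrC.
rewrite -subr_le0; set e := _ - _ in step *.
rewrite leNgt; apply/negP => e0.
(* [step] gives e <= t (e + c), and this t makes t (e + c) smaller than e / 2 *)
pose t := e / (2 * (e + c + 1)).
have d0 : 0 < 2 * (e + c + 1) by lra.
have t0 : 0 < t by rewrite divr_gt0.
have tE : t * (2 * (e + c + 1)) = e by rewrite divfK ?gt_eqF.
have t1 : t < 1 by rewrite ltr_pdivrMr// mul1r; lra.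
have := step t; rewrite t0 t1 => /(_ isT).
nra.
Qed.

End Perturbation.

End Forms.

(** * Gram-Schmidt orthonormalization *)

Section GramSchmidt.
Variable R : rcfType.
Local Notation C := R[i].
Variable B : {poly C} -> {poly C} -> C.
Hypotheses (hB : hermitian_form B) (dB : definite B).

(** Orthogonality to all polynomials of smaller degree, rather than to the
    previous members of a sequence, makes the condition on each degree
    independent of the choices made for the other degrees. *)
Let gs_spec n (p : {poly C}) := [/\ size p = n.+1, 0 < lead_coef p,
  B p p = 1 & forall q : {poly C}, (size q <= n)%N -> B q p = 0].

Let gram_schmidt_step n (f : nat -> {poly C}) :
  (forall k, (k < n)%N -> gs_spec k (f k)) -> exists p, gs_spec n p.
Proof.
move=> fP.
pose s := \sum_(k < n) B 'X^n (f k) *: f k.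
have ss : (size s <= n)%N.
  rewrite (leq_trans (size_sum _ _ _))//; apply/bigmax_leqP => k _.
  rewrite (leq_trans (size_scale_leq _ _))//.
  by have [-> _ _ _] := fP k (ltn_ord k).
pose p := 'X^n - s.
have sp : size p = n.+1 by rewrite size_polyDl ?size_polyXn// size_polyN ltnS.
have lp : lead_coef p = 1.
  by rewrite lead_coefDl ?lead_coefXn// size_polyXn size_polyN ltnS.
have fp k : (k < n)%N -> B (f k) p = 0.
  move=> kn; rewrite (formC hB) -[RHS]conjc0; congr conjc.
  rewrite /p (formBl hB) /s.
  rewrite (scalar_sum _ (fun k => B 'X^n (f k)) _ (form_scalar hB _)).
  have [sk _ nk ok] := fP k kn.
  rewrite (bigD1 (Ordinal kn))//= nk mulr1 big1 ?addr0 ?subrr// => i.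
  rewrite -val_eqE/= neq_ltn => ik; have [si _ _ oi] := fP i (ltn_ord i).
  case/orP: ik => ik; first by rewrite ok ?mulr0 ?si.
  by rewrite (formC hB (f k)) (oi (f k)) ?sk// rmorph0 mulr0.
have qp (q : {poly C}) : (size q <= n)%N -> B q p = 0.
  have sf k : (k < n)%N -> size (f k) = k.+1 by case/fP.
  move=> /(graded_span sf)[a ->].
  rewrite (scalar_sum _ _ _ (form_scalar hB _)) big1// => i _.
  by rewrite fp ?mulr0.
have Bp0 : 0 < complex.Re (B p p).
  rewrite lt_neqAle (form_ge0 hB) andbT; apply/eqP => /esym/dB p0.
  by have := sp; rewrite p0 size_poly0.
set x := complex.Re (B p p) in Bp0.
have BpE : B p p = x%:C%C by apply: complex_eq; rewrite ?(Im_form hB).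
pose c := (Num.sqrt x)^-1.
have c0 : 0 < c by rewrite invr_gt0 sqrtr_gt0.
have cc0 : 0 < c%:C%C :> C by rewrite ltcR.
exists (c%:C%C *: p); split.
- by rewrite size_scale// gt_eqF.
- by rewrite lead_coefZ lp mulr1.
- rewrite (formZl hB) (formZr hB) BpE conjc_real -!rmorphM/=.
  by rewrite mulrA -expr2 exprVn sqr_sqrtr ?ltW// mulVf ?gt_eqF.
- by move=> q sq; rewrite (formZr hB) qp ?mulr0.
Qed.

Lemma gram_schmidt : exists phi, orthonormal_seq B phi.
Proof.
pose phi k := xget 0 [set p | gs_spec k p].
have phiP k : gs_spec k (phi k).
  have [n] := ubnP k; elim: n k => // n IH k; rewrite ltnS => kn.
  have [p pk] := gram_schmidt_step
    (fun j (jk : (j < k)%N) => IH j (leq_trans jk kn)).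
  exact: (xgetPex 0 (ex_intro _ p pk)).
exists phi; split=> [k|k|k l]; try by case: (phiP k).
have [sk _ nk ok] := phiP k; have [sl _ nl ol] := phiP l.
case: (ltngtP k l) => [kl|lk|<-//]; first by rewrite ol ?sk.
by rewrite (formC hB (phi l)) ok ?sl// rmorph0.
Qed.

End GramSchmidt.

(** * Polynomials on the unit circle *)

Lemma double_roots_lt_size (F : fieldType) (rs : seq F) (W : {poly F}) :
  W != 0 -> uniq rs -> {in rs, forall z, root W z /\ root W^`() z} ->
  ((size rs).*2 < size W)%N.
Proof.
elim: rs W => [|z rs IH] W W0; first by rewrite size_poly_gt0.
move=> /= /andP[zrs urs] dW; have [|/factor_theorem[V WE] dWz] := dW z.
  by rewrite mem_head.
have /factor_theorem[U VE] : root V z.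
  by move: dWz; rewrite WE derivM derivXsubC /root !(hornerE, subrr).
have {}WE : W = U * ('X - z%:P) ^+ 2 by rewrite WE VE -mulrA.
have U0 : U != 0 by apply: contraNneq W0 => U0; rewrite WE U0 mul0r.
have -> : size W = (size U).+2.
  rewrite WE size_Mmonic ?monicXn ?monic_exp ?monicXsubC//.
  by rewrite size_exp_XsubC addn3.
rewrite doubleS !ltnS; apply: IH => // y yrs.
have yz : y - z != 0.
  by rewrite subr_eq0; apply: contraNneq zrs => <-.
have [|Wy dWy] := dW y; first by rewrite inE yrs orbT.
have Uy : root U y.
  by move: Wy; rewrite WE /root !hornerE !mulf_eq0 (negbTE yz) !orbF.
split=> //; move: dWy; rewrite WE derivM /root !hornerE.
by rewrite (rootP Uy) mul0r addr0 !mulf_eq0 (negbTE yz) !orbF.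
Qed.

Section Circle.
Variable R : realType.
Local Notation C := R[i].
Implicit Types (p q : {poly C}) (t : R).

Lemma sqmod_expi t : sqmod (expi t) = 1.
Proof. exact: cos2Dsin2. Qed.

Lemma expi_conjc t : expi t * conjc (expi t) = 1.
Proof. by rewrite mulc_conjc sqmod_expi. Qed.

Lemma expi0 : expi (0 : R) = 1.
Proof. by rewrite /expi cos0 sin0. Qed.

(** This replaces 2 pi-periodicity: what is known on [arc] for a function of
    [expi t] extends to the whole line, which gives maximum points at the end
    pi of the arc a two-sided neighbourhood. *)
Lemma expi_arc t : exists2 s, arc R s & expi s = expi t.
Proof.
have c1 : -1 <= cos t <= 1 by rewrite cos_geN1 cos_le1.
have sE : sin (acos (cos t)) = `|sin t|.
  by rewrite sin_acos// -sin2cos2 sqrtr_sqr.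
have cE : cos (acos (cos t)) = cos t by rewrite acosK// in_itv.
have a0 := acos_ge0 c1; have api := acos_lepi c1; have pi0 := @pi_gt0 R.
have [st|st] := leP 0 (sin t).
  exists (acos (cos t)); first by rewrite /arc/= in_itv/= api andbT; lra.
  by rewrite /expi cE sE ger0_norm.
exists (- acos (cos t)); last first.
  by rewrite /expi cosN sinN cE sE ltr0_norm// opprK.
rewrite /arc/= in_itv/= ltrN2; apply/andP; split; last by lra.
apply: acos_ltpi; rewrite cos_le1 andbT lt_neqAle cos_geN1 andbT eq_sym.
apply/eqP => c; have := cos2Dsin2 t; rewrite c sqrrN expr1n.
move=> h; have s0 : sin t ^+ 2 == 0 by apply/eqP; lra.
by move: s0 st; rewrite sqrf_eq0 => /eqP ->; rewrite ltxx.
Qed.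

Lemma expi_inj_arc : {in arc R &, injective (@expi R)}.
Proof.
have pi0 := @pi_gt0 R.
move=> s t; rewrite !inE /arc/= !in_itv/=.
move=> /andP[s1 s2] /andP[t1 t2] [cst sst].
have nst : `|s| = `|t|.
  apply: cos_inj; rewrite ?cos_norm// in_itv/= normr_ge0 ler_norml.
    by rewrite s2 ltW.
  by rewrite t2 ltW.
have /orP[/eqP//|/eqP sNt] : (s == t) || (s == - t) by rewrite -eqr_norm2 nst.
have st0 : sin t = 0 by move: sst; rewrite sNt sinN; lra.
have [t0|t0|t0] := ltgtP t 0.
- have : 0 < sin (- t) by apply: sin_gt0_pi; apply/andP; split; lra.
  by rewrite sinN st0 oppr0 ltxx.
- have [tpi|tpi] := ltP t pi; last by lra.
  by have := @sin_gt0_pi R t; rewrite t0 tpi st0 ltxx => /(_ isT).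
- by rewrite sNt t0 oppr0.
Qed.

Lemma is_derive_horner_expi p t :
  is_derive t 1 (fun t => complex.Re p.[expi t])
    (complex.Re (p^`().[expi t] * ('i%C * expi t))) /\
  is_derive t 1 (fun t => complex.Im p.[expi t])
    (complex.Im (p^`().[expi t] * ('i%C * expi t))).
Proof.
elim/poly_ind: p => [|p c [IHr IHi]].
  rewrite deriv0 horner0 mul0r/=; split.
    by under eq_fun do rewrite horner0; exact: is_derive_cst.
  by under eq_fun do rewrite horner0; exact: is_derive_cst.
have cosd := is_derive_cos t; have sind := is_derive_sin t.
split.
- under eq_fun do rewrite !hornerE Re_addc Re_mulc/=.
  apply: is_derive_eq.
  rewrite derivD derivM derivX derivC !hornerE.
  by rewrite !(Re_mulc, Im_mulc, Re_addc, Im_addc) /GRing.scale/=; ring.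
- under eq_fun do rewrite !hornerE Im_addc Im_mulc/=.
  apply: is_derive_eq.
  rewrite derivD derivM derivX derivC !hornerE.
  by rewrite !(Re_mulc, Im_mulc, Re_addc, Im_addc) /GRing.scale/=; ring.
Qed.

Lemma continuous_Re_horner_expi p : continuous (fun t => complex.Re p.[expi t]).
Proof.
move=> t; apply: differentiable_continuous; apply/derivable1_diffP.
by have [[]] := is_derive_horner_expi p t.
Qed.

Lemma continuous_Im_horner_expi p : continuous (fun t => complex.Im p.[expi t]).
Proof.
move=> t; apply: differentiable_continuous; apply/derivable1_diffP.
by have [_ []] := is_derive_horner_expi p t.
Qed.

Lemma continuous_sqmod_horner_expi p : continuous (fun t => sqmod p.[expi t]).
Proof.
move=> t; rewrite /sqmod; apply: cvgD.
  apply: (@cvgM R R _ _ _ (fun t => complex.Re p.[expi t]));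
    exact: continuous_Re_horner_expi.
apply: (@cvgM R R _ _ _ (fun t => complex.Im p.[expi t]));
  exact: continuous_Im_horner_expi.
Qed.

(** Q vanishes at its minimum together with its derivative; so does
    t |-> W(e^(it)) = e^(int) Q(t), whose derivative is i e^(it) W'(e^(it)). *)
Lemma double_root_of_min n (W : {poly C}) (Q : R -> R) t :
  (forall s, W.[expi s] = expi s ^+ n * (Q s)%:C%C) ->
  (forall s, 0 <= Q s) -> Q t = 0 ->
  root W (expi t) /\ root W^`() (expi t).
Proof.
move=> WE Q0 Qt.
have rW : root W (expi t) by rewrite /root WE Qt mulr0.
split=> //.
(* Q is smooth because Q(t) = Re(conj(e^(int)) W(e^(it))) *)
have QE s : Q s = complex.Re ('X^n : {poly C}).[expi s] * complex.Re W.[expi s]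
  + complex.Im ('X^n : {poly C}).[expi s] * complex.Im W.[expi s].
  rewrite hornerXn WE Re_mulc Im_mulc/=.
  have : sqmod (expi s ^+ n) = 1.
    apply: (@complexI R); rewrite -mulc_conjc rmorphXn -exprMn expi_conjc.
    by rewrite expr1n.
  rewrite /sqmod => h; rewrite -[LHS]mul1r -h; ring.
have QF : Q = (fun s =>
    complex.Re ('X^n : {poly C}).[expi s] * complex.Re W.[expi s]
  + complex.Im ('X^n : {poly C}).[expi s] * complex.Im W.[expi s]).
  exact/funext.
have dX s := is_derive_horner_expi ('X^n) s.
have dW s := is_derive_horner_expi W s.
have dQ s : derivable Q s 1.
  rewrite QF; have [[? _] [? _]] := dX s; have [[? _] [? _]] := dW s.
  by apply: derivableD; apply: derivableM.
have dQt : is_derive t 1 Q 0.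
  have dNQ : is_derive t 1 (\- Q) 0.
    apply: (@derive1_at_max _ _ (t - 1) (t + 1)).
    - by lra.
    - by move=> s _; apply: derivableN; exact: dQ.
    - by rewrite in_itv/=; apply/andP; split; lra.
    - by move=> s _; rewrite lerN2 Qt.
  split; first exact: dQ.
  have [dN DN] := dNQ.
  move: DN; rewrite deriveN; last exact: dQ.
  by move=> /eqP; rewrite oppr_eq0 => /eqP.
have WRe : (fun s => complex.Re W.[expi s]) =
    (fun s => complex.Re ('X^n : {poly C}).[expi s]) * Q.
  by apply/funext => s; rewrite WE mulrfctE hornerXn Re_mulc/= mulr0 subr0.
have WIm : (fun s => complex.Im W.[expi s]) =
    (fun s => complex.Im ('X^n : {poly C}).[expi s]) * Q.
  by apply/funext => s; rewrite WE mulrfctE hornerXn Im_mulc/= mulr0 add0r.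
have [dXr dXi] := dX t.
have [dWr dWi] := dW t.
have Wr0 : complex.Re (W^`().[expi t] * ('i%C * expi t)) = 0.
  rewrite -(@derive_val _ _ _ _ _ _ _ dWr) WRe derive_val Qt.
  by rewrite !scaler0 scale0r addr0.
have Wi0 : complex.Im (W^`().[expi t] * ('i%C * expi t)) = 0.
  rewrite -(@derive_val _ _ _ _ _ _ _ dWi) WIm derive_val Qt.
  by rewrite !scaler0 scale0r addr0.
have /eqP : W^`().[expi t] * ('i%C * expi t) = 0 by exact: complex_eq.
have e0 : 'i%C * expi t != 0 :> C.
  apply/eqP => /(congr1 (@sqmod R)); rewrite /sqmod Re_mulc Im_mulc/=.
  by have := cos2Dsin2 t; nra.
by rewrite mulf_eq0 (negbTE e0) orbF.
Qed.

End Circle.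

(** * Contact points of a trigonometric polynomial *)

Section TrigPoly.
Variable R : realType.
Local Notation C := R[i].
Implicit Types (p q : {poly C}) (t : R).

Lemma circle_max (f : R -> R) :
  continuous f -> (forall s t, expi s = expi t -> f s = f t) ->
  exists2 t0, arc R t0 & forall t, f t <= f t0.
Proof.
move=> cf fE; have pi0 := @pi_gt0 R.
have [|c _ fc] := @EVT_max R f (- pi) pi _ (continuous_subspaceT cf).
  by lra.
have [t0 At0 /fE t0c] := expi_arc c.
exists t0 => // t; have [s] := expi_arc t.
rewrite /arc/= in_itv/= => /andP[s1 s2] /fE <-; rewrite t0c fc// in_itv/=.
by rewrite (ltW s1).
Qed.

(** The reversed polynomial p^* of degree n: since conj(z) = 1/z on the circle,
    it turns z^n |p(z)|^2 into the polynomial p p^*. *)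
Definition conj_reverse n p := \poly_(i < n.+1) conjc p`_(n - i).

Lemma horner_conj_reverse n p t : (size p <= n.+1)%N ->
  (conj_reverse n p).[expi t] = expi t ^+ n * conjc p.[expi t].
Proof.
move=> sp; rewrite horner_poly (reindex_inj rev_ord_inj)/=.
rewrite (horner_coef_wide _ sp) rmorph_sum big_distrr; apply: eq_bigr => i _ /=.
have ni : (i <= n)%N by rewrite -ltnS.
rewrite subSS subKn// rmorphM rmorphXn mulrCA; congr (_ * _).
have -> : expi t ^+ n = expi t ^+ (n - i) * expi t ^+ i.
  by rewrite -exprD subnK.
by rewrite -mulrA -exprMn expi_conjc expr1n mulr1.
Qed.

Lemma coefM_top (S : nzRingType) (p q : {poly S}) m n :
  (size p <= m.+1)%N -> (size q <= n.+1)%N -> (p * q)`_(m + n) = p`_m * q`_n.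
Proof.
move=> sp sq; rewrite coefM.
have mn : (m < (m + n).+1)%N by rewrite ltnS leq_addr.
rewrite (bigD1 (Ordinal mn))//= addKn big1 ?addr0// => i.
rewrite -val_eqE/= neq_ltn => /orP[im|mi].
  by rewrite [q`__]nth_default ?mulr0// (leq_trans sq)// ltn_subRL ltn_add2r.
by rewrite [p`__]nth_default ?mul0r// (leq_trans sp).
Qed.

(** z^n (M - |p1|^2 + |p2|^2) is on the circle a polynomial W of degree at most
    2n. Since deg p1 < n, its coefficient of z^(2n) comes from |p2|^2 alone. *)
Lemma size_touching_points n p1 p2 (M : R) (s : seq R) :
  (0 < n)%N -> (size p1 <= n)%N -> (size p2 <= n.+1)%N ->
  p2`_n != 0 -> p2.[0] != 0 ->
  (forall t, sqmod p1.[expi t] - sqmod p2.[expi t] <= M) ->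
  uniq s ->
  {in s, forall t, arc R t /\ sqmod p1.[expi t] - sqmod p2.[expi t] = M} ->
  (size s <= n)%N.
Proof.
move=> n0 sp1 sp2 p2n p20 leM us sM.
pose W := M%:C%C *: 'X^n - p1 * conj_reverse n p1 + p2 * conj_reverse n p2.
have srev p : (size (conj_reverse n p) <= n.+1)%N by exact: size_poly.
have WE t : W.[expi t] = expi t ^+ n *
    (M - (sqmod p1.[expi t] - sqmod p2.[expi t]))%:C%C.
  rewrite /W !hornerE !horner_conj_reverse// ?(leq_trans sp1)//.
  rewrite !rmorphB/= -!mulc_conjc; ring.
have Wn : W`_(n + n) != 0.
  rewrite !coefE (coefM_top sp2 (srev p2)) coef_poly ltnSn subnn.
  rewrite (coefM_top (leq_trans sp1 (leqnSn n)) (srev p1)) (nth_default 0 sp1).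
  have -> : (n + n == n)%N = false.
    by rewrite -[X in _ == X]add0n eqn_add2r gtn_eqF.
  rewrite mulr0 mul0r subr0 add0r.
  by rewrite mulf_neq0// conjc_eq0 -horner_coef0.
have W0 : W != 0 by apply: contraNneq Wn => ->; rewrite coef0.
have sM2 (p : {poly C}) : (size p <= n.+1)%N ->
    (size (p * conj_reverse n p)%R <= (n + n).+1)%N.
  move=> sp; rewrite (leq_trans (size_polyMleq _ _))// -subn1 leq_subLR add1n.
  by rewrite (leq_trans (leq_add sp (srev p)))// addnS.
have sW : (size W <= (n + n).+1)%N.
  rewrite (leq_trans (size_polyD _ _))// geq_max sM2// andbT.
  rewrite (leq_trans (size_polyD _ _))// geq_max size_polyN.
  rewrite sM2 ?(leq_trans sp1)//.
  by rewrite andbT (leq_trans (size_scale_leq _ _))// size_polyXn ltnS leq_addr.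
pose rs := [seq expi t | t <- s].
have urs : uniq rs.
  rewrite map_inj_in_uniq// => x y xs ys; apply: expi_inj_arc; rewrite inE.
    by have [] := sM x xs.
  by have [] := sM y ys.
have drs : {in rs, forall z, root W z /\ root W^`() z}.
  move=> _ /mapP[t ts ->]; apply: double_root_of_min WE _ _ => [u|].
    by rewrite subr_ge0.
  by have [_ ->] := sM t ts; rewrite subrr.
have := leq_trans (double_roots_lt_size W0 urs drs) sW.
by rewrite size_map addnn ltnS leq_double.
Qed.

Lemma bounded_card_enum (T : choiceType) (Z : set T) n :
  (forall s : seq T, uniq s -> {in s, forall x, Z x} -> (size s <= n)%N) ->
  exists s : seq T, [/\ uniq s, (size s <= n)%N & Z = [set` s]].
Proof.
move=> Zn.
pose P k :=
  `[< exists s : seq T, [/\ uniq s, {in s, forall x, Z x} & size s = k] >].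
have exP : exists k, P k by exists 0; apply/asboolP; exists [::].
have Pn k : P k -> (k <= n)%N by move=> /asboolP[s [us sZ <-]]; exact: Zn.
case: (ex_maxnP exP Pn) => k /asboolP[s [us sZ sk]] kmax.
exists s; split=> //; first exact: Zn.
apply/seteqP; split=> x /=; last exact: sZ.
move=> Zx; apply: contraT => xs.
have : P k.+1.
  apply/asboolP; exists (x :: s); split; rewrite /= ?sk ?us ?andbT//.
  by move=> y; rewrite inE => /predU1P[->//|/sZ].
by move=> /kmax; rewrite ltnn.
Qed.

End TrigPoly.

(** * Integration of functions on the circle *)

Section CircleFun.
Variable R : realType.
Local Notation C := R[i].
Local Notation T := (measurableTypeR R).
Local Notation measureR := {measure set T -> \bar R}.
Implicit Types (p q r : {poly C}) (t : R) (f g : T -> R) (m : measureR).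

(** Continuous functions on the circle, read on the line. They are bounded and
    measurable, hence integrable on [arc] for every measure that is finite
    there; all integrands below are of this kind. *)
Record circle_fun f : Prop := CircleFun {
  circle_fun_continuous : continuous (f : R -> R);
  circle_fun_expi : forall s t, expi s = expi t -> f s = f t }.

Lemma circle_fun_cst (a : R) : circle_fun (fun=> a).
Proof. by split=> // t; exact: cvg_cst. Qed.

Lemma circle_funD f g : circle_fun f -> circle_fun g ->
  circle_fun (fun t => f t + g t).
Proof.
move=> [cf fe] [cg ge]; split=> [t|s t st]; last by rewrite (fe s t)// (ge s t).
by apply: (@cvgD _ R^o R); [exact: cf|exact: cg].
Qed.

Lemma circle_funM f g : circle_fun f -> circle_fun g ->
  circle_fun (fun t => f t * g t).
Proof.
move=> [cf fe] [cg ge]; split=> [t|s t st]; last by rewrite (fe s t)// (ge s t).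
by apply: (@cvgM R R); [exact: cf|exact: cg].
Qed.

Lemma circle_funZ (a : R) f : circle_fun f -> circle_fun (fun t => a * f t).
Proof. by move=> cf; apply: circle_funM => //; exact: circle_fun_cst. Qed.

Lemma circle_fun_bounded f : circle_fun f -> exists K, forall t, `|f t| <= K.
Proof.
move=> cf.
have [M1 _ fM1] := circle_max (circle_fun_continuous cf) (circle_fun_expi cf).
have cNf := circle_funZ (-1) cf.
have [M2 _ fM2] := circle_max (circle_fun_continuous cNf) (circle_fun_expi cNf).
exists (`|f M1| + `|f M2|) => t; rewrite ler_norml.
have := fM1 t; have := fM2 t.
have := ler_norm (f M1); have := ler_norm (- f M2).
have := normr_ge0 (f M1); have := normr_ge0 (f M2); rewrite normrN.
move=> ? ? ? ? ? ?; apply/andP; split; lra.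
Qed.

Lemma circle_fun_measurable f (D : set T) : circle_fun f -> measurable_fun D f.
Proof.
move=> [cf _]; apply/measurable_funTS.
exact: continuous_measurable_fun.
Qed.

Lemma circle_fun_integrable m f : (m (arc R) < +oo)%E -> circle_fun f ->
  m.-integrable (arc R) (EFin \o f).
Proof.
move=> fm cf; apply: measurable_bounded_integrable => //.
- exact: measurable_arc.
- exact: circle_fun_measurable.
- have [K fK] := circle_fun_bounded cf; exists K; split; first exact: num_real.
  by move=> x Kx t _ /=; rewrite (le_trans (fK t))// ltW.
Qed.

Lemma Rintegral_linear m (a b : R) f g : (m (arc R) < +oo)%E ->
  circle_fun f -> circle_fun g ->
  Rintegral m (arc R) (fun t => a * f t + b * g t) =
  a * Rintegral m (arc R) f + b * Rintegral m (arc R) g.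
Proof.
move=> fm cf cg; have mA := @measurable_arc R.
rewrite RintegralD//;
  try by apply: circle_fun_integrable => //; exact: circle_funZ.
by rewrite !RintegralZl//; exact: circle_fun_integrable.
Qed.

Lemma Rintegral_measure_comb (m m1 m2 : measureR) (a b : R) f :
  0 <= a -> 0 <= b -> (m1 (arc R) < +oo)%E -> (m2 (arc R) < +oo)%E ->
  (forall A, measurable A -> m A = (a%:E * m1 A + b%:E * m2 A)%E) ->
  circle_fun f ->
  Rintegral m (arc R) f =
  a * Rintegral m1 (arc R) f + b * Rintegral m2 (arc R) f.
Proof.
move=> a0 b0 fm1 fm2 mE cf; have mA := @measurable_arc R.
have fm : (m (arc R) < +oo)%E.
  by rewrite mE// lte_add_pinfty// lte_mul_pinfty// ?lee_fin.
(* adding a constant makes f nonnegative, where mixtures are integrated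
   without integrability conditions *)
wlog f0 : f cf / forall t, 0 <= f t => [ge0|].
  have [K fK] := circle_fun_bounded cf.
  have K0 : 0 <= K by rewrite (le_trans _ (fK 0)).
  have cK := circle_fun_cst K.
  have cfK := circle_funD cf cK.
  have fE m' : (m' (arc R) < +oo)%E -> Rintegral m' (arc R) f =
      Rintegral m' (arc R) (fun t => f t + K) - Rintegral m' (arc R) (fun=> K).
    move=> fm'; rewrite -[X in X - _]mul1r -mulN1r -Rintegral_linear//.
    by apply: eq_Rintegral => t _; ring.
  rewrite !fE// ge0//; last first.
    by move=> t; have := fK t; rewrite ler_norml => /andP[]; lra.
  by rewrite (ge0 (fun=> K))//; ring.
have mf : measurable_fun (arc R) f by exact: circle_fun_measurable.
have f0' t : arc R t -> (0 <= (EFin \o f) t)%E by rewrite lee_fin.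
rewrite /Rintegral.
rewrite (@eq_measure_integral _ _ _ _
  (measure_add (mscale (NngNum a0) m1) (mscale (NngNum b0) m2))); last first.
  by move=> A mA' _; rewrite mE //; apply: esym; exact: measure_addE.
rewrite ge0_integral_measure_add//; last exact/measurable_EFinP.
rewrite !ge0_integral_mscale//=; try exact/measurable_EFinP.
have i1 : (\int[m1]_(x in arc R) (f x)%:E)%E \is a fin_num.
  by apply: integrable_fin_num => //; exact: circle_fun_integrable.
have i2 : (\int[m2]_(x in arc R) (f x)%:E)%E \is a fin_num.
  by apply: integrable_fin_num => //; exact: circle_fun_integrable.
by rewrite fineD ?fineM// fin_numM.
Qed.

Lemma Rintegral_eq0_null m f : (m (arc R) < +oo)%E -> circle_fun f ->
  (forall t, 0 <= f t) -> Rintegral m (arc R) f = 0 ->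
  exists N : set T, [/\ measurable N, m N = 0%E &
    forall t, arc R t -> f t != 0 -> N t].
Proof.
move=> fm cf f0 intf0; have mA := @measurable_arc R.
have intf : (\int[m]_(t in arc R) `|(f t)%:E|)%E = 0%E.
  under eq_integral do rewrite gee0_abs ?lee_fin//.
  rewrite -[LHS]fineK; first by rewrite -[fine _]/(Rintegral _ _ _) intf0.
  by apply: integrable_fin_num => //; exact: circle_fun_integrable.
have mf : measurable_fun (arc R) (fun t : T => (f t)%:E).
  by apply/measurable_EFinP; exact: circle_fun_measurable.
have [N [mN N0 sN]] := (ae_eq_integral_abs _ mA mf).1 intf.
exists N; split=> // t At ft; apply: sN => h; have [ft0] := h At.
by rewrite ft0 eqxx in ft.
Qed.

Lemma circle_fun_Re_horner p : circle_fun (fun t => complex.Re p.[expi t]).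
Proof. by split=> [|s t ->//]; exact: continuous_Re_horner_expi. Qed.

Lemma circle_fun_Im_horner p : circle_fun (fun t => complex.Im p.[expi t]).
Proof. by split=> [|s t ->//]; exact: continuous_Im_horner_expi. Qed.

Lemma circle_fun_Re_inner p q :
  circle_fun (fun t => complex.Re (p.[expi t] * conjc q.[expi t])).
Proof.
under eq_fun do rewrite Re_mulc Re_conjc Im_conjc mulrN opprK.
by apply: circle_funD; apply: circle_funM;
  exact: circle_fun_Re_horner || exact: circle_fun_Im_horner.
Qed.

Lemma circle_fun_Im_inner p q :
  circle_fun (fun t => complex.Im (p.[expi t] * conjc q.[expi t])).
Proof.
under eq_fun do rewrite Im_mulc Re_conjc Im_conjc mulrN -mulN1r.
apply: circle_funD; first apply: circle_funZ; apply: circle_funM;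
  exact: circle_fun_Re_horner || exact: circle_fun_Im_horner.
Qed.

Lemma circle_fun_sqmod p : circle_fun (fun t => sqmod p.[expi t]).
Proof. by split=> [|s t ->//]; exact: continuous_sqmod_horner_expi. Qed.

Section InnerForm.
Variable m : measureR.
Hypothesis fm : (m (arc R) < +oo)%E.

Lemma Re_inner_diag p :
  complex.Re (inner m p p) = Rintegral m (arc R) (fun t => sqmod p.[expi t]).
Proof. by apply: eq_Rintegral => t _; rewrite mulc_conjc. Qed.

Lemma inner_hermitian : hermitian_form (inner m).
Proof.
split=> [r a p q|p q|p].
- have cRp := circle_fun_Re_inner p r; have cIp := circle_fun_Im_inner p r.
  have cRq := circle_fun_Re_inner q r; have cIq := circle_fun_Im_inner q r.
  apply: complex_eq; rewrite ?Re_addc ?Im_addc ?Re_mulc ?Im_mulc/=.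
  + have cf := circle_funD (circle_funZ (complex.Re a) cRp)
      (circle_funZ (- complex.Im a) cIp).
    have E := Rintegral_linear 1 1 fm cf cRq.
    rewrite (Rintegral_linear _ _ fm cRp cIp) in E.
    apply: etrans (etrans _ E) _; last by ring.
    apply: eq_Rintegral => t _.
    by rewrite hornerD hornerZ mulrDl -mulrA Re_addc Re_mulc; ring.
  + have cf := circle_funD (circle_funZ (complex.Re a) cIp)
      (circle_funZ (complex.Im a) cRp).
    have E := Rintegral_linear 1 1 fm cf cIq.
    rewrite (Rintegral_linear _ _ fm cIp cRp) in E.
    apply: etrans (etrans _ E) _; last by ring.
    apply: eq_Rintegral => t _.
    by rewrite hornerD hornerZ mulrDl -mulrA Im_addc Im_mulc; ring.
- apply: complex_eq; rewrite ?Re_conjc ?Im_conjc/=.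
    by apply: eq_Rintegral => t _; rewrite !Re_mulc !Re_conjc !Im_conjc; ring.
  have cI := circle_fun_Im_inner p q.
  apply: etrans (etrans _ (Rintegral_linear (-1) 0 fm cI cI)) _; last by ring.
  by apply: eq_Rintegral => t _; rewrite !Im_mulc !Re_conjc !Im_conjc; ring.
- by rewrite Re_inner_diag; apply: Rintegral_ge0 => t _; exact: sqmod_ge0.
Qed.

Lemma inner_isometric_shift : isometric_shift (inner m).
Proof.
move=> p q; rewrite /inner; congr Cintegral; apply/funext => t.
by rewrite !hornerM hornerX rmorphM mulrACA expi_conjc mul1r.
Qed.

End InnerForm.

End CircleFun.

(** * Steklov measures *)

Section UnitMeasure.
Context d (T : measurableType d) (R : realType).
Variables (m : {measure set T -> \bar R}) (m1 : m setT = 1%E).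

(** The proof is an argument so that canonical structures can depend on it. *)
Definition unit_measure of m setT = 1%E : set T -> \bar R := m.

HB.instance Definition _ := Measure.copy (unit_measure m1) m.
HB.instance Definition _ :=
  Measure_isProbability.Build d T R (unit_measure m1) m1.

Lemma probability_of_measure : exists P : probability T R, forall A, P A = m A.
Proof. by exists (unit_measure m1). Qed.

End UnitMeasure.

Section DensityMeasure.
Context d (T : measurableType d) (R : realType).
Variables (m : {measure set T -> \bar R}) (f : T -> \bar R).
Hypotheses (mf : measurable_fun setT f) (f0 : forall t, (0 <= f t)%E).

Definition density_measure
    of measurable_fun setT f & (forall t, (0 <= f t)%E) :=
  fun A : set T => (\int[m]_(t in A) f t)%E.

Let density_measure0 : density_measure mf f0 set0 = 0%E.
Proof. exact: integral_set0. Qed.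

Let density_measure_ge0 A : (0 <= density_measure mf f0 A)%E.
Proof. exact: integral_ge0. Qed.

Let density_measure_sigma_additive :
  semi_sigma_additive (density_measure mf f0).
Proof. exact: semi_sigma_additive_nng_induced. Qed.

HB.instance Definition _ := isMeasure.Build d T R (density_measure mf f0)
  density_measure0 density_measure_ge0 density_measure_sigma_additive.

Lemma density_measure_exists : exists m' : {measure set T -> \bar R},
  forall A : set T, m' A = (\int[m]_(t in A) f t)%E.
Proof. by exists (density_measure mf f0). Qed.

End DensityMeasure.

Section Steklov.
Variable R : realType.
Local Notation C := R[i].
Local Notation T := (measurableTypeR R).
Local Notation measureR := {measure set T -> \bar R}.
Implicit Types (p q : {poly C}) (t : R) (m : measureR).

Lemma dtheta_arc : dtheta R (arc R) = (2 * pi)%:E.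
Proof.
have pi0 := @pi_gt0 R.
rewrite /dtheta/= /mrestr setIid /arc lebesgue_measure_itv/= lte_fin.
by rewrite ifT -?EFinD; [congr EFin; ring|lra].
Qed.

Lemma dtheta_setCarc : dtheta R (~` arc R) = 0.
Proof. by rewrite /dtheta/= /mrestr setICl measure0. Qed.

Lemma dtheta_fin : (dtheta R (arc R) < +oo)%E.
Proof. by rewrite dtheta_arc ltry. Qed.

(** A nonzero polynomial has finitely many zeros on the circle, a null set of
    angles, while the arc has positive length. *)
Lemma dtheta_definite p :
  Rintegral (dtheta R) (arc R) (fun t => sqmod p.[expi t]) = 0 -> p = 0.
Proof.
move=> int0; apply/eqP; apply: contraT => p0.
have mA := @measurable_arc R.
have cs := circle_fun_sqmod p.
have [N [mN N0 sN]] :=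
  Rintegral_eq0_null dtheta_fin cs (fun t => sqmod_ge0 _) int0.
pose Z := [set t : R | arc R t /\ p.[expi t] = 0].
have [s [_ _ ZE]] :
    exists s : seq R, [/\ uniq s, (size s <= size p)%N & Z = [set` s]].
  apply: bounded_card_enum => s us sZ; rewrite -(size_map (@expi R)) ltnW//.
  apply: max_poly_roots => //.
    by apply/allP => _ /mapP[t /sZ[_ pt] ->]; rewrite /root pt.
  rewrite map_inj_in_uniq// => x y xs ys; apply: expi_inj_arc; rewrite inE.
    by have [] := sZ x xs.
  by have [] := sZ y ys.
have Z0 : dtheta R Z = 0%E.
  rewrite /dtheta/= /mrestr ZE; apply: countable_lebesgue_measure0.
  apply: (@sub_countable _ _ _ [set` s]).
    by apply: subset_card_le => x [].
  exact/finite_set_countable/finite_seq.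
have mZ : measurable Z.
  rewrite ZE; apply: countable_measurable => [t|]; first exact: measurable_set1.
  exact/finite_set_countable/finite_seq.
have : (dtheta R (arc R) <= dtheta R (N `|` Z))%E.
  apply: le_measure; rewrite ?inE//; first exact: measurableU.
  move=> t At; have [pt|pt] := eqVneq p.[expi t] 0; first by right.
  by left; apply: sN => //; apply: contra_neq pt => /sqmod_eq0.
rewrite leNgt => /negP[]; rewrite (@le_lt_trans _ _ 0%E)//.
  apply: (le_trans (measureU2 _ mN mZ)).
  by rewrite /= N0 [X in (_ + X)%E]Z0 adde0.
by rewrite dtheta_arc lte_fin mulr_gt0// pi_gt0.
Qed.


Lemma measure_comb_exists m1 m2 (a b : R) : 0 <= a -> 0 <= b ->
  exists m, forall A, m A = (a%:E * m1 A + b%:E * m2 A)%E.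
Proof.
move=> a0 b0.
exists (measure_add (mscale (NngNum a0) m1) (mscale (NngNum b0) m2)) => A.
exact: measure_addE.
Qed.

(** rho is the singular part plus the measure of density sigma' - c, truncated
    at 0 because sigma' >= c holds almost everywhere only. *)
Lemma steklov_split (delta : R) (sigma : probability T R) :
  0 < delta -> steklov delta sigma ->
  exists rho : measureR, forall A, measurable A ->
    sigma A = ((delta / (2 * pi))%:E * dtheta R A + rho A)%E.
Proof.
move=> d0 [_ [f [mf f0 [s _ sE]] cf]].
set c := delta / (2 * pi) in cf *.
have c0 : 0 <= c by rewrite divr_ge0 ?mulr_ge0 ?pi_ge0// ltW.
pose g t := Num.max (f t - c) 0.
have mg : measurable_fun setT g.
  by apply: measurable_maxr => //; exact: measurable_funB.
have g0 t : 0 <= g t by rewrite le_max lexx orbT.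
have mEg : measurable_fun setT (EFin \o g) by exact/measurable_EFinP.
have [nu nuE] := density_measure_exists (dtheta R) mEg g0.
have [rho rhoE] := measure_comb_exists nu s ler01 ler01.
exists rho => A mA; rewrite rhoE !mul1e addeA sE//; congr (_ + _)%E.
have -> : (\int[dtheta R]_(t in A) (f t)%:E =
    \int[dtheta R]_(t in A) (c%:E + (g t)%:E))%E.
  apply: ae_eq_integral => //.
  - exact/measurable_EFinP/measurable_funTS.
  - by apply: emeasurable_funD => //; exact: measurable_funTS.
  - apply: filterS cf => t ct _; rewrite -EFinD /g max_l ?subr_ge0//.
    by rewrite addrC subrK.
rewrite ge0_integralD//; last exact: measurable_funTS.
  by rewrite integral_cst// nuE.
by move=> t _; rewrite lee_fin.
Qed.

Lemma steklov_arc_fin (delta : R) (sigma : probability T R) :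
  steklov delta sigma -> (sigma (arc R) < +oo)%E.
Proof. by move=> [-> _]; rewrite ltry. Qed.

Lemma inner_definite (delta : R) (sigma : probability T R) :
  0 < delta -> steklov delta sigma -> definite (inner sigma).
Proof.
move=> d0 Ssigma p; have fs := steklov_arc_fin Ssigma.
have [rho sE] := steklov_split d0 Ssigma.
set c := delta / (2 * pi) in sE.
have c0 : 0 < c by rewrite divr_gt0// mulr_gt0 ?pi_gt0.
have mA := @measurable_arc R.
have frho : (rho (arc R) < +oo)%E.
  rewrite (le_lt_trans _ fs)// sE// leeDr//.
  by rewrite mule_ge0// lee_fin ltW.
have cp := circle_fun_sqmod p.
rewrite Re_inner_diag.
rewrite (@Rintegral_measure_comb _ _ _ rho c 1 _ _ _ dtheta_fin)//; last 2 first.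
- exact: ltW.
- by move=> A mA'; rewrite mul1e; exact: sE.
rewrite mul1r => /eqP; rewrite paddr_eq0; last 2 first.
- rewrite mulr_ge0 ?(ltW c0)//.
  by apply: Rintegral_ge0 => t _; exact: sqmod_ge0.
- by apply: Rintegral_ge0 => t _; exact: sqmod_ge0.
rewrite mulf_eq0 gt_eqF//= => /andP[/eqP h _].
exact: dtheta_definite.
Qed.

Lemma opoly_orthonormal (delta : R) (sigma : probability T R) :
  0 < delta -> steklov delta sigma ->
  orthonormal_seq (inner sigma) (opoly sigma).
Proof.
move=> d0 Ssigma; have hB := inner_hermitian (steklov_arc_fin Ssigma).
have [phi hphi] := gram_schmidt hB (inner_definite d0 Ssigma).
exact: (xgetPex _ (ex_intro _ phi hphi)).
Qed.

End Steklov.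

Section SteklovMix.
Variable R : realType.
Local Notation T := (measurableTypeR R).
Local Notation measureR := {measure set T -> \bar R}.

(** The measure nu is the competitor of the variational argument. A density and
    a singular part for the mixture are (1 - t) sigma' + t c and
    (1 - t) s + t (1 - delta) (point mass at theta). *)
Lemma steklov_mix (delta t theta : R) (mu : probability T R) (nu : measureR) :
  0 < delta < 1 -> steklov delta mu -> 0 < t < 1 -> arc R theta ->
  (forall A, nu A = ((delta / (2 * pi))%:E * dtheta R A
                     + (1 - delta)%:E * \d_theta A)%E) ->
  exists2 sigma : probability T R, steklov delta sigma &
    forall A, sigma A = ((1 - t)%:E * mu A + t%:E * nu A)%E.
Proof.
move=> /andP[d0 d1] [mu1 [f [mf f0 [s [E [mE sE dE]] muE]] cf]].
move=> /andP[t0 t1] Atheta nuE.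
set c := delta / (2 * pi) in nuE cf *.
have c0 : 0 < c by rewrite divr_gt0// mulr_gt0 ?pi_gt0.
have t1' : 0 <= 1 - t by rewrite subr_ge0 ltW.
have d1' : 0 <= 1 - delta by rewrite subr_ge0 ltW.
have mA := @measurable_arc R.
have cpi : c * (2 * pi) = delta by rewrite divfK// gt_eqF// mulr_gt0 ?pi_gt0.
have nu_arc : nu (arc R) = 1%E.
  rewrite nuE dtheta_arc diracE mem_set// -!EFinM -EFinD cpi mulr1.
  by rewrite addrC subrK.
have nuT : nu setT = 1%E.
  have -> : (nu setT = nu (arc R) + nu (~` arc R))%E.
    rewrite -(setUv (arc R)); apply: measureU => //; first exact: measurableC.
    exact: setICr.
  rewrite nu_arc nuE dtheta_setCarc diracE memNset ?mule0 ?adde0//.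
have [m mME] := measure_comb_exists mu nu t1' (ltW t0).
have {}mME A : m A = ((1 - t)%:E * mu A + t%:E * nu A)%E by exact: mME.
have m1 : m setT = 1%E.
  by rewrite mME nuT probability_setT !mule1 -EFinD subrK.
have [sigma sigmaE] := probability_of_measure m1.
exists sigma; last by move=> A; rewrite sigmaE mME.
split.
  by rewrite /circle_probability sigmaE mME nu_arc mu1 !mule1 -EFinD subrK.
have [s' s'E] := measure_comb_exists s (dirac (theta : T) : measureR)
  t1' (mulr_ge0 (ltW t0) d1').
have {}s'E (A : set T) : s' A =
    ((1 - t)%:E * s A + (t * (1 - delta))%:E * (theta \in A)%:R%:E)%E.
  exact: s'E.
exists (fun x => (1 - t) * f x + t * c); last first.
  apply: filterS cf => x cx.
  have : 0 <= (1 - t) * (f x - c) by rewrite mulr_ge0// subr_ge0.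
  rewrite -/c; lra.
split.
- by apply: measurable_funD => //; exact: measurable_funM.
- by move=> x; apply: addr_ge0; apply: mulr_ge0 => //; exact: ltW.
exists s'.
  exists (E `|` [set theta]); split.
  - exact: measurableU.
  - rewrite s'E memNset ?mule0 ?adde0; last first.
      by apply; right.
    suff -> : s (~` (E `|` [set theta])) = 0%E by rewrite mule0.
    apply/eqP; rewrite -measure_le0 -sE; apply: le_measure; rewrite ?inE.
    + by apply: measurableC; exact: measurableU.
    + exact: measurableC.
    + by move=> x /= nEx Ex; apply: nEx; left.
  - apply/eqP; rewrite -measure_le0.
    apply: (le_trans (measureU2 _ mE _)) => //.
    rewrite /= [X in (X + _)%E]dE add0e /dtheta/= /mrestr.
    rewrite (@le_trans _ _ (@lebesgue_measure R [set theta]))//.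
      by apply: le_measure; rewrite ?inE//; exact: measurableI.
    by rewrite lebesgue_measure_set1.
move=> A mA'; transitivity (m A); first exact: sigmaE.
have muAE : mu A = (\int[dtheta R]_(t in A) (f t)%:E + s A)%E by exact: muE.
rewrite mME muAE nuE s'E diracE.
have -> : (\int[dtheta R]_(x in A) ((1 - t) * f x + t * c)%:E =
    (1 - t)%:E * \int[dtheta R]_(x in A) (f x)%:E + (t * c)%:E * dtheta R A)%E.
  under eq_integral do rewrite EFinD EFinM.
  rewrite ge0_integralD//.
  - rewrite ge0_integralZl//.
    + by rewrite integral_cst.
    + exact/measurable_EFinP/measurable_funTS.
    + by move=> x _; rewrite lee_fin.
  - by move=> x _; rewrite mule_ge0// lee_fin.
  - by apply/measurable_EFinP/measurable_funTS; exact: measurable_funM.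
  - by move=> x _; rewrite lee_fin mulr_ge0// ltW.
have i0 : (0 <= \int[dtheta R]_(x in A) (f x)%:E)%E.
  by apply: integral_ge0 => x _; rewrite lee_fin.
move: (integral _ _ _) i0 => I I0.
rewrite !ge0_muleDr ?mule_ge0 ?lee_fin ?(ltW c0)//.
by rewrite !EFinM !muleA addeACA.
Qed.

Lemma measure_finite_set d (S : measurableType d)
    (m : {measure set S -> \bar R}) (s : seq S) (A : set S) :
  (forall x : S, measurable [set x]) ->
  measurable A -> uniq s ->
  m (A `&` [set` s]) = (\sum_(x <- s) m [set x] * \d_x A)%E.
Proof.
move=> m1 mA; elim: s => [_|x s IH /= /andP[xs us]].
  by rewrite big_nil set_nil setI0 measure0.
have ms : measurable [set` s].
  by apply: countable_measurable => //; exact/finite_set_countable/finite_seq.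
have -> : [set` x :: s] = [set x] `|` [set` s].
  by apply/seteqP; split=> y /=; rewrite inE => /predU1P.
have -> : (m (A `&` ([set x] `|` [set` s])) =
    m (A `&` [set x]) + m (A `&` [set` s]))%E.
  rewrite setIUr; apply: measureU; [exact: measurableI|exact: measurableI|].
  apply/seteqP; split=> // y [[_ ->] [_ ys]].
  by move: ys; rewrite /= (negbTE xs).
rewrite big_cons IH// diracE; congr (_ + _)%E.
have [xA|xA] := pselect (A x).
  by rewrite mem_set// mule1 setIidr// => _ ->.
rewrite memNset// mule0 (_ : A `&` [set x] = set0) ?measure0//.
by apply/seteqP; split=> // y [+ yx]; rewrite yx.
Qed.

Lemma cmod_sqr (z : R[i]) : cmod z ^+ 2 = sqmod z.
Proof. by rewrite /cmod normc_def sqr_sqrtr ?sqmod_ge0. Qed.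

Lemma cmod_ge0 (z : R[i]) : 0 <= cmod z.
Proof. by rewrite /cmod normc_def sqrtr_ge0. Qed.

(** [Linfty_norm] is an essential supremum, but p is continuous: if |p(1)|
    exceeded it, |p| would exceed it on a set of angles of positive length. *)
Lemma cmod_le_Linfty (p : {poly R[i]}) : ((cmod p.[1])%:E <= Linfty_norm p)%E.
Proof.
have pi0 := @pi_gt0 R.
have mA := @measurable_arc R.
have T0 : (0 < dtheta R setT)%E.
  rewrite (@lt_le_trans _ _ (dtheta R (arc R)))//.
    by rewrite dtheta_arc lte_fin mulr_gt0.
  by apply: le_measure; rewrite ?inE.
rewrite /Linfty_norm unlock T0; set h := (X in ess_sup _ X).
have hE t : h t = (cmod p.[expi t])%:E by rewrite /h/= ger0_norm// cmod_ge0.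
rewrite leNgt; apply/negP => lt1.
have [N [mN N0 sN]] := ess_sup_ge (dtheta R) h.
have [r r0 hr] : exists2 r, r < cmod p.[1] &
    forall t, r < cmod p.[expi t] -> N t.
  move: lt1 sN; case: ess_sup => [r|//|] lt1 sN.
    exists r => // t rt; apply: sN => /=; rewrite hE lee_fin => /le_lt_trans.
    by move=> /(_ _ rt); rewrite ltxx.
  exists (cmod p.[1] - 1); first by lra.
  by move=> t _; apply: sN => /=; rewrite hE.
have cm : continuous (fun t : R => cmod p.[expi t]).
  move=> t; rewrite /cmod; under eq_fun do rewrite normc_def/=.
  apply: (@continuous_comp _ _ _ (fun t => sqmod p.[expi t]) (@Num.sqrt R)).
    exact: continuous_sqmod_horner_expi.
  exact: sqrt_continuous.
have : \forall t \near (0 : R), r < cmod p.[expi t].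
  by apply: (cvgr_gt _ (cm 0)); rewrite expi0.
move=> /nbhs_ballP[e /= e0 he].
pose b := Num.min e pi.
have b0 : 0 < b by rewrite lt_min e0 pi0.
have : (dtheta R `]0%R, b[%classic <= dtheta R N)%E.
  apply: le_measure; rewrite ?inE// => t /=; rewrite in_itv/= => /andP[ht0 tb].
  apply: hr; apply: he; rewrite /ball/= sub0r normrN gtr0_norm//.
  by move: tb; rewrite lt_min => /andP[].
rewrite [X in (_ <= X)%E]N0 leNgt => /negP[].
rewrite /dtheta/= /mrestr setIidl; last first.
  move=> t /=; rewrite /arc/= !in_itv/= lt_min => /andP[ht0 /andP[_ /ltW ->]].
  by rewrite andbT; lra.
by rewrite lebesgue_measure_itv/= lte_fin b0 sube0 lte_fin.
Qed.

End SteklovMix.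

(** * The maximizer *)

Section Maximizer.
Variable R : realType.
Local Notation T := (measurableTypeR R).
Local Notation measureR := {measure set T -> \bar R}.

(** The function whose integral against nu - mu is the derivative of
    |phi_n(1)|^2 at mu in the direction of nu. *)
Definition kernel_gap (phi : nat -> {poly R[i]}) (n : nat) : T -> R := fun t =>
  sqmod (kernel_at1 phi n).[expi t] - sqmod (kernel_at1 phi n.+1).[expi t].

Lemma circle_fun_kernel_gap phi n : circle_fun (kernel_gap phi n).
Proof.
rewrite /kernel_gap; under eq_fun do rewrite -mulN1r.
by apply: circle_funD; last apply: circle_funZ; exact: circle_fun_sqmod.
Qed.

Lemma sqmod_opoly_le_max (delta : R) n (mu sigma : probability T R) :
  (cmod (opoly mu n).[1])%:E = steklov_sup n delta -> steklov delta sigma ->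
  sqmod (opoly sigma n).[1] <= sqmod (opoly mu n).[1].
Proof.
move=> mumax Ssigma; rewrite -!cmod_sqr lerXn2r ?nnegrE ?cmod_ge0//.
rewrite -lee_fin mumax (le_trans (cmod_le_Linfty _))//.
by apply: ereal_sup_ubound; exists sigma.
Qed.

Lemma maximizer_first_order (delta theta : R) n
    (mu : probability T R) (nu : measureR) :
  0 < delta < 1 -> steklov delta mu ->
  (cmod (opoly mu n).[1])%:E = steklov_sup n delta -> arc R theta ->
  (nu (arc R) < +oo)%E ->
  (forall A, nu A = ((delta / (2 * pi))%:E * dtheta R A
                     + (1 - delta)%:E * \d_theta A)%E) ->
  Rintegral nu (arc R) (kernel_gap (opoly mu) n) <=
  Rintegral mu (arc R) (kernel_gap (opoly mu) n).
Proof.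
move=> d01 Smu mumax Atheta fnu nuE.
have d0 : 0 < delta by case/andP: d01.
have fmu := steklov_arc_fin Smu.
have hphi := opoly_orthonormal d0 Smu.
have hmu := inner_hermitian fmu; have hnu := inner_hermitian fnu.
have gapE (m : measureR) (k := kernel_at1 (opoly mu)) :
    (m (arc R) < +oo)%E ->
    Rintegral m (arc R) (kernel_gap (opoly mu) n) =
    complex.Re (inner m (k n) (k n)) - complex.Re (inner m (k n.+1) (k n.+1)).
  move=> fm; rewrite !Re_inner_diag /kernel_gap.
  have := Rintegral_linear 1 (-1) fm (circle_fun_sqmod (k n))
    (circle_fun_sqmod (k n.+1)).
  rewrite mul1r mulN1r => <-.
  by apply: eq_Rintegral => t _; rewrite mul1r mulN1r.
rewrite !gapE//; apply: (first_variation hmu hnu hphi) => t t01.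
have [sigma Ssigma sigmaE] := steklov_mix d01 Smu t01 Atheta nuE.
exists (opoly sigma); last exact: (sqmod_opoly_le_max mumax Ssigma).
have -> : mix (inner mu) (inner nu) t = inner sigma.
  have [t0 t1] : 0 <= t /\ 0 <= 1 - t by case/andP: t01; split; lra.
  apply/funext => p; apply/funext => q; apply/esym.
  have comb f : circle_fun f -> Rintegral sigma (arc R) f =
      (1 - t) * Rintegral mu (arc R) f + t * Rintegral nu (arc R) f.
    by apply: Rintegral_measure_comb => // A _; exact: sigmaE.
  apply: complex_eq; rewrite /mix ?Re_addc ?Im_addc ?Re_mulc ?Im_mulc/=.
    by rewrite comb ?mul0r ?subr0//; exact: circle_fun_Re_inner.
  by rewrite comb ?mul0r ?addr0//; exact: circle_fun_Im_inner.
exact: opoly_orthonormal d0 Ssigma.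
Qed.

(** Comparing mu = c dtheta + rho with nu = c dtheta + (1 - delta) (point mass
    at theta), the common part cancels: rho has mass 1 - delta, and gap(theta) -
    gap is nonnegative with nonpositive integral against rho. *)
Lemma residual_concentrated (delta theta : R) n
    (mu : probability T R) (rho : measureR) (gap := kernel_gap (opoly mu) n) :
  0 < delta < 1 -> steklov delta mu ->
  (cmod (opoly mu n).[1])%:E = steklov_sup n delta ->
  arc R theta -> (forall t, gap t <= gap theta) ->
  (forall A, measurable A ->
    mu A = ((delta / (2 * pi))%:E * dtheta R A + rho A)%E) ->
  exists N : set T, [/\ measurable N, rho N = 0%E &
    forall t, ~ (arc R t /\ gap t = gap theta) -> N t].
Proof.
move=> d01 Smu mumax Atheta gapmax muE.
have /andP[d0 d1] := d01.
set c := delta / (2 * pi) in muE.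
have c0 : 0 < c by rewrite divr_gt0// mulr_gt0 ?pi_gt0.
have d1' : 0 <= 1 - delta by rewrite subr_ge0 ltW.
have cpi : c * (2 * pi) = delta by rewrite divfK// gt_eqF// mulr_gt0 ?pi_gt0.
have mA := @measurable_arc R.
have mu1 : mu (arc R) = 1%E by have [] := Smu.
have mu0 : mu (~` arc R) = 0%E by rewrite probability_setC// mu1 subee.
have rho_arc : rho (arc R) = (1 - delta)%:E.
  have := muE _ mA; rewrite mu1 dtheta_arc -EFinM cpi.
  case: (rho (arc R)) => [x|//|//]; rewrite -EFinD => -[h].
  by congr EFin; lra.
have rho_setC : rho (~` arc R) = 0%E.
  have := muE _ (measurableC mA); rewrite mu0 dtheta_setCarc mule0 add0e.
  by move=> <-.
have frho : (rho (arc R) < +oo)%E by rewrite rho_arc ltry.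
have cgap : circle_fun gap := circle_fun_kernel_gap (opoly mu) n.
pose dirac_theta : measureR := dirac (theta : T).
have [nu nuE] := measure_comb_exists (dtheta R) dirac_theta (ltW c0) d1'.
have dirac_arc : dirac_theta (arc R) = 1%E.
  by rewrite -[LHS]/((theta \in arc R)%:R%:E) mem_set.
have fdirac : (dirac_theta (arc R) < +oo)%E by rewrite dirac_arc ltry.
have fnu : (nu (arc R) < +oo)%E.
  by rewrite nuE dirac_arc dtheta_arc -!EFinM -EFinD ltry.
have := maximizer_first_order d01 Smu mumax Atheta fnu nuE.
rewrite -/gap (Rintegral_measure_comb (ltW c0) d1' (dtheta_fin R) fdirac
  (fun A _ => nuE A) cgap).
have muE' A : measurable A -> mu A = (c%:E * dtheta R A + 1%:E * rho A)%E.
  by move=> mA'; rewrite mul1e; exact: muE.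
rewrite (Rintegral_measure_comb (ltW c0) ler01 (dtheta_fin R) frho muE' cgap).
rewrite mul1r lerD2l.
have -> : Rintegral dirac_theta (arc R) gap = gap theta.
  rewrite /Rintegral integral_dirac//.
    by rewrite diracE mem_set// mul1e.
  by apply/measurable_EFinP; exact: circle_fun_measurable.
move=> first_order.
have cdef : circle_fun (fun t => 1 * gap theta + -1 * gap t).
  by apply: circle_funD; apply: circle_funZ => //; exact: circle_fun_cst.
have def_ge0 t : 0 <= 1 * gap theta + -1 * gap t.
  by rewrite mul1r mulN1r subr_ge0.
have [||N [mN N0 sN]] := Rintegral_eq0_null frho cdef _ _; first by [].
  apply/le_anti; rewrite Rintegral_ge0// andbT.
  rewrite (Rintegral_linear 1 (-1) frho (circle_fun_cst (gap theta)) cgap).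
  rewrite Rintegral_cst// rho_arc/=; lra.
exists (N `|` ~` arc R); split.
- by apply: measurableU => //; exact: measurableC.
- apply/eqP; rewrite -measure_le0.
  apply: (le_trans (measureU2 _ mN (measurableC mA))).
  by rewrite [X in (X + _)%E]N0 [X in (_ + X)%E]rho_setC adde0.
- move=> t nZ; have [At|] := pselect (arc R t); last by right.
  left; apply: sN => //; apply/eqP => h; apply: nZ; split=> //; lra.
Qed.

End Maximizer.

Theorem theorem1p2 (R : realType) (delta : R) (n : nat)
    (mu : probability (measurableTypeR R) R) :
  0 < delta < 1 -> (0 < n)%N ->
  steklov delta mu ->
  (cmod (opoly mu n).[1])%:E = steklov_sup n delta ->
  exists (N : nat) (m theta : 'I_N -> R),
    [/\ (1 <= N <= n)%N,
        forall j, 0 <= m j,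
        forall j, - pi < theta j <= pi,
        forall i j : 'I_N, (i < j)%N -> theta i < theta j &
        forall A : set (measurableTypeR R), measurable A ->
          mu A = ((delta / (2 * pi))%:E * dtheta R A
                  + \sum_(j < N) (m j)%:E * \d_(theta j) A)%E].
Proof.
move=> d01 n0 Smu mumax; have /andP[d0 d1] := d01.
have fmu := steklov_arc_fin Smu.
have hmu := inner_hermitian fmu.
have hphi := opoly_orthonormal d0 Smu.
have shmu := @inner_isometric_shift R mu.
set gap := kernel_gap (opoly mu) n.
have [cgap gapE] := circle_fun_kernel_gap (opoly mu) n.
have [theta0 Atheta0 gapmax] := circle_max cgap gapE.
have [rho muE] := steklov_split d0 Smu.
have [N [mN rhoN sN]] := residual_concentrated d01 Smu mumax Atheta0 gapmax muE.
pose Z := [set t | arc R t /\ gap t = gap theta0].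
have [s0 [us0 ss0 Zs0]] :
    exists s : seq R, [/\ uniq s, (size s <= n)%N & Z = [set` s]].
  apply: bounded_card_enum => s us sZ.
  exact: (size_touching_points n0 (size_kernel_at1 hphi n)
    (size_kernel_at1 hphi n.+1) (kernel_at1_top hmu hphi shmu n)
    (kernel_at1_at0 hmu hphi shmu n) gapmax us sZ).
pose s := sort <=%R s0.
have ss : size s = size s0 by rewrite size_sort.
have Zs t : Z t <-> t \in s by rewrite Zs0 mem_sort.
have Zth (j : 'I_(size s)) : Z (nth 0 s j) by apply/Zs; rewrite mem_nth.
have rho_fin x : rho [set x] \is a fin_num.
  have mx : measurable ([set x] : set (measurableTypeR R)).
    exact: measurable_set1.
  have mux : mu [set x] =
      ((delta / (2 * pi))%:E * dtheta R [set x] + rho [set x])%E.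
    exact: muE.
  rewrite ge0_fin_numE// (@le_lt_trans _ _ (mu [set x]))//.
    rewrite mux leeDr// mule_ge0// lee_fin divr_ge0 ?mulr_ge0 ?pi_ge0// ltW//.
  by rewrite (le_lt_trans (probability_le1 _ mx))// ltry.
exists (size s), (fun j => fine (rho [set nth 0 s j])), (fun j => nth 0 s j).
split.
- rewrite ss ss0 andbT -ss; have /Zs : Z theta0 by [].
  by case: (s).
- by move=> j; rewrite fine_ge0.
- by move=> j; have [] := Zth j; rewrite /arc/= in_itv.
- move=> i j ij.
  have := sort_lt_sorted s0; rewrite us0 -/s => lts.
  by apply: (sorted_ltn_nth lt_trans 0 lts) => //; rewrite inE.
move=> A mA; rewrite [LHS]muE//; congr (_ + _)%E.
have us : uniq s by rewrite sort_uniq.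
have ms : measurable ([set` s] : set (measurableTypeR R)).
  apply: countable_measurable => [t|]; first exact: measurable_set1.
  exact/finite_set_countable/finite_seq.
have -> : rho A = rho (A `&` [set` s]).
  rewrite (measureDI rho mA ms) [X in (X + _)%E](_ : _ = 0%E) ?add0e//.
  apply/eqP; rewrite -measure_le0 -rhoN; apply: le_measure; rewrite ?inE//.
    exact: measurableD.
  by move=> t [_ ts]; apply: sN => /Zs.
rewrite measure_finite_set//.
rewrite (big_nth 0) big_mkord; apply: eq_bigr => j _.
by rewrite fineK.
Qed.
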